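(* Let $P\subseteq M_{\mathbb R}$ be a $d$-dimensional reflexive polytope, and let $\mathcal W(P)$ be the graph with vertex set $\partial P\cap M$ in which two distinct points are joined by an edge if and only if they are contained in a common facet of $P$. 1. Any pair of points in $\partial P\cap M$ can be connected by at most three edges of the graph $\mathcal W(P)$ (i.e. their distance in $\mathcal W(P)$ is at most three), with equality only possibly occurring for a centrally symmetric pair of points $x,-x$. In particular the diameter of the graph $\mathcal W(P)$ is at most three. 2. The previous statements also hold for the restriction of $\mathcal W(P)$ to the set of vertices $\mathcal V(P)$ of $P$ (the induced subgraph), which is a purely combinatorial object. In the case of a simplicial polytope $P$ this is just the usual edge-graph on the vertices of $P$. 3. By dualizing one gets: any pair of facets of $P$ either is parallel, or contains a common vertex, or there is another facet of $P$ with which each of the two has non-trivial (i.e. non-empty) intersection.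
   Context: $M\cong\mathbb Z^d$ is a lattice with dual lattice $N$, $M_{\mathbb R}=M\otimes\mathbb R$, $N_{\mathbb R}=N\otimes\mathbb R$. A reflexive polytope is a $d$-dimensional lattice polytope $P\subseteq M_{\mathbb R}$ (vertices in $M$) with $0\in\mathrm{int}\,P$ whose dual $P^*=\{y\in N_{\mathbb R}:\langle x,y\rangle\ge -1\ \forall x\in P\}$ is a lattice polytope. $\mathcal V(P)$ denotes the set of vertices and $\partial P$ the boundary of $P$. A polytope is simplicial if all its facets are simplices. Two facets are parallel if their affine hulls are parallel hyperplanes.
   Formalization: Parts 1 and 2 (apart from the claim that the vertex graph is purely combinatorial) are stated for d ≠ 1: for d = 1, P = [-1,1] gives a graph W(P) with two vertices and no edge, so the distance is infinite and it differs from the usual edge-graph. *)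

(* Defs.v *)
From HB Require Import structures.
From mathcomp Require Import all_boot all_order all_algebra.
From mathcomp Require Import all_classical all_reals all_analysis.

Set Implicit Arguments.
Unset Strict Implicit.
Unset Printing Implicit Defensive.

Import Order.TTheory GRing.Theory Num.Theory.
Import numFieldNormedType.Exports.

Local Open Scope classical_set_scope.
Local Open Scope ring_scope.

(** A choice of basis identifies the lattice M, and with the dual basis the
    dual lattice N, with the integer vectors of R^d; M_R and N_R both become
    'rV[R]_d, paired by the standard bilinear form. *)

Definition pairing (R : realType) (d : nat) (x y : 'rV[R]_d) : R :=
  \sum_(i < d) x 0 i * y 0 i.

Definition lattice (R : realType) (d : nat) : set 'rV[R]_d :=
  [set x | forall i, x 0 i \is a Num.int].

Definition convex_hull (R : realType) (d : nat) (A : set 'rV[R]_d) :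
    set 'rV[R]_d :=
  [set x | exists n (p : 'I_n -> 'rV[R]_d) (c : 'I_n -> R),
     [/\ forall i, A (p i), forall i, 0 <= c i, \sum_i c i = 1 &
         x = \sum_i c i *: p i]].

Definition affine_hull (R : realType) (d : nat) (A : set 'rV[R]_d) :
    set 'rV[R]_d :=
  [set x | exists n (p : 'I_n -> 'rV[R]_d) (c : 'I_n -> R),
     [/\ forall i, A (p i), \sum_i c i = 1 & x = \sum_i c i *: p i]].

Definition affinely_independent (R : realType) (d n : nat)
    (p : 'I_n -> 'rV[R]_d) : Prop :=
  forall c : 'I_n -> R,
    \sum_i c i = 0 -> \sum_i c i *: p i = 0 -> forall i, c i = 0.

(** The affine hull of [A] has dimension [k]; the empty set has none. *)
Definition has_dim (R : realType) (d : nat) (A : set 'rV[R]_d) (k : nat) :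
    Prop :=
  exists2 p : 'I_k.+1 -> 'rV[R]_d,
    affinely_independent p & affine_hull A = affine_hull (range p).

Definition polytope (R : realType) (d : nat) (P : set 'rV[R]_d) : Prop :=
  exists2 A : set 'rV[R]_d, finite_set A & P = convex_hull A.

Definition hyperplane (R : realType) (d : nat) (u : 'rV[R]_d) (c : R) :
    set 'rV[R]_d :=
  [set x | pairing x u = c].

(** [u] may be zero, so the empty set and [P] itself are (improper) faces. *)
Definition face (R : realType) (d : nat) (P F : set 'rV[R]_d) : Prop :=
  exists u c, (forall x, P x -> c <= pairing x u) /\ F = P `&` hyperplane u c.

Definition vertices (R : realType) (d : nat) (P : set 'rV[R]_d) :
    set 'rV[R]_d :=
  [set v | face P [set v]].

(** For polytopes of full dimension [d] only. *)
Definition facet (R : realType) (d : nat) (P F : set 'rV[R]_d) : Prop :=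
  face P F /\ exists2 k, d = k.+1 & has_dim F k.

Definition boundary (R : realType) (d : nat) (P : set 'rV[R]_d) :
    set 'rV[R]_d :=
  closure P `\` interior P.

Definition dual_polytope (R : realType) (d : nat) (P : set 'rV[R]_d) : set 'rV[R]_d :=
  [set y | forall x, P x -> -1 <= pairing x y].

Definition lattice_polytope (R : realType) (d : nat) (P : set 'rV[R]_d) :
    Prop :=
  polytope P /\ vertices P `<=` @lattice R d.

Definition reflexive_polytope (R : realType) (d : nat) (P : set 'rV[R]_d) :
    Prop :=
  [/\ lattice_polytope P, has_dim P d, interior P 0 &
      lattice_polytope (dual_polytope P)].

Definition simplex (R : realType) (d : nat) (F : set 'rV[R]_d) : Prop :=
  exists n (p : 'I_n -> 'rV[R]_d),
    affinely_independent p /\ F = convex_hull (range p).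

Definition simplicial (R : realType) (d : nat) (P : set 'rV[R]_d) : Prop :=
  forall F, facet P F -> simplex F.

Definition parallel (R : realType) (d : nat) (F G : set 'rV[R]_d) : Prop :=
  exists u : 'rV[R]_d, u != 0 /\
    exists a b, affine_hull F = hyperplane u a /\
                affine_hull G = hyperplane u b.

Definition combinatorially_equivalent (R : realType) (d e : nat)
    (P : set 'rV[R]_d) (Q : set 'rV[R]_e) : Prop :=
  exists2 phi : set 'rV[R]_d -> set 'rV[R]_e,
    set_bij (face P) (face Q) phi &
    forall F G, face P F -> face P G -> (F `<=` G <-> phi F `<=` phi G).

Record graph (T : Type) := Graph {
  gvert : set T;
  gadj : T -> T -> Prop
}.

Definition induced_subgraph (T : Type) (G : graph T) (A : set T) : graph T :=
  Graph A (fun x y => [/\ A x, A y & gadj G x y]).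

Fixpoint walk (T : Type) (G : graph T) (n : nat) (x y : T) : Prop :=
  match n with
  | 0 => gvert G x /\ x = y
  | m.+1 => exists z, [/\ gvert G x, gadj G x z & walk G m z y]
  end.

(** Infinite when no walk joins the two points. *)
Definition gdist (R : realType) (T : Type) (G : graph T) (x y : T) : \bar R :=
  ereal_inf [set (n%:R)%:E | n in [set n | walk G n x y]].

Definition gdiam (R : realType) (T : Type) (G : graph T) : \bar R :=
  ereal_sup [set gdist R G x y | x in gvert G & y in gvert G].

Definition graph_isomorphic (T U : Type) (G : graph T) (H : graph U) : Prop :=
  exists2 f : T -> U,
    set_bij (gvert G) (gvert H) f &
    forall x y, gvert G x -> gvert G y -> (gadj G x y <-> gadj H (f x) (f y)).

Definition facet_graph (R : realType) (d : nat) (P : set 'rV[R]_d) :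
    graph 'rV[R]_d :=
  let V := boundary P `&` @lattice R d in
  Graph V (fun x y => [/\ V x, V y, x <> y &
                          exists F, [/\ facet P F, F x & F y]]).

Definition edge_graph (R : realType) (d : nat) (P : set 'rV[R]_d) :
    graph 'rV[R]_d :=
  let V := vertices P in
  Graph V (fun x y => [/\ V x, V y, x <> y &
                          exists E, [/\ face P E, has_dim E 1, E x & E y]]).

(* Main.v *)
Require Import Defs.
From HB Require Import structures.
From mathcomp Require Import all_boot all_order all_algebra.
From mathcomp Require Import all_classical all_reals all_analysis.
From mathcomp Require Import ring lra.
Set Implicit Arguments.
Unset Strict Implicit.
Unset Printing Implicit Defensive.
Import Order.TTheory GRing.Theory Num.Theory.
Import numFieldNormedType.Exports.
Local Open Scope classical_set_scope.
Local Open Scope ring_scope.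

(** Let [Q] be the dual polytope of [P], which is again reflexive.  The facets of
    [P] are the sets of points of [P] where some vertex [b] of [Q] takes the value
    -1, and on lattice points of [P] such a [b] takes only integer values [>= -1].

    Let [x] and [y] be nonzero lattice points of [P] with [y <> - x] that lie on
    no common facet.  No vertex of [Q] takes the value -1 at both, hence each of
    them is at least -1 at [x + y], by integrality: [x + y] is a nonzero lattice
    point of [P], so some [b] is -1 at [x + y].  By integrality again [b] is -1 at
    one of the two points, say [x], and 0 at the other.  Repeat with [x + y] in
    place of [x]: the points [x + k * y] remain on the facet [b] until one of them
    shares a facet with [y], which must happen because [P] is bounded.  That point
    is a common neighbour of [x] and [y] ([cofacial_middle]).  The two facets
    involved meet in a nonempty face, so one of its vertices is a common neighbour
    as well ([cofacial_middle_vertex]).  Distance three can thus occur only for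
    [y = - x]; then it is enough to move first to another vertex of a facet
    through [x], which exists if the dimension is at least two.  The statement on
    pairs of facets is the one on pairs of vertices, for [Q].

    What has to be known about polytopes is elementary, because both [P] and [Q]
    are hulls of finite sets.  Farkas' lemma gives biduality
    ([dual_dual_polytope]).  Perturbing a functional by a small multiple of
    another one gives transitivity of the face relation and, by descent, a
    minimizing vertex on each nonempty face ([face_trans], [min_vertex]).  A proper
    nonempty face is cut out by a point of [Q], and the points of [Q] whose dual
    face contains it form a face of [Q]; any vertex of the latter gives a facet
    containing the given face ([proper_face_sub], [facet_dual_face],
    [facet_dual_faceP]).  In particular, two vertices are adjacent if and only if
    some proper face contains both, which is why the graph on the vertices depends
    only on the face lattice ([combinatorial_vertex_graph]).  In a simplicial
    polytope it is the edge graph, since any two vertices of a simplex span an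
    edge ([simplex_edge]). *)

(** * The pairing *)

Section Pairing.
Context {R : realType} {d : nat}.
Implicit Types x y z u : 'rV[R]_d.

Lemma rV_dim0 x y : d = 0%N -> x = y.
Proof. by move=> d0; move: x y; rewrite d0 => x y; rewrite !thinmx0. Qed.

Lemma pairingC x y : pairing x y = pairing y x.
Proof. by apply: eq_bigr => i _; rewrite mulrC. Qed.

Lemma pairingDl x y z : pairing (x + y) z = pairing x z + pairing y z.
Proof. by rewrite -big_split /=; apply: eq_bigr => i _; rewrite mxE mulrDl. Qed.

Lemma pairingZl a x y : pairing (a *: x) y = a * pairing x y.
Proof. by rewrite mulr_sumr; apply: eq_bigr => i _; rewrite mxE mulrA. Qed.

Lemma pairingNl x y : pairing (- x) y = - pairing x y.
Proof. by rewrite -scaleN1r pairingZl mulN1r. Qed.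

Lemma pairing0l y : pairing 0 y = 0.
Proof. by rewrite -(scale0r 0) pairingZl mul0r. Qed.

Lemma pairingBl x y z : pairing (x - y) z = pairing x z - pairing y z.
Proof. by rewrite pairingDl pairingNl. Qed.

Lemma pairing_suml I (r : seq I) (Q : pred I) (F : I -> 'rV[R]_d) y :
  pairing (\sum_(i <- r | Q i) F i) y = \sum_(i <- r | Q i) pairing (F i) y.
Proof.
exact: (big_morph (fun x => pairing x y) (fun x z => pairingDl x z y)
  (pairing0l y)).
Qed.

Lemma pairingDr x y z : pairing x (y + z) = pairing x y + pairing x z.
Proof. by rewrite pairingC pairingDl !(pairingC x). Qed.

Lemma pairingZr a x y : pairing x (a *: y) = a * pairing x y.
Proof. by rewrite pairingC pairingZl (pairingC x). Qed.

Lemma pairingNr x y : pairing x (- y) = - pairing x y.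
Proof. by rewrite pairingC pairingNl (pairingC x). Qed.

Lemma pairingBr x y z : pairing x (y - z) = pairing x y - pairing x z.
Proof. by rewrite pairingDr pairingNr. Qed.

Lemma pairing0r x : pairing x 0 = 0.
Proof. by rewrite pairingC pairing0l. Qed.

Lemma pairing_sumr I (r : seq I) (Q : pred I) (F : I -> 'rV[R]_d) x :
  pairing x (\sum_(i <- r | Q i) F i) = \sum_(i <- r | Q i) pairing x (F i).
Proof.
by rewrite pairingC pairing_suml; apply: eq_bigr => i _; apply: pairingC.
Qed.

Lemma pairing_ge0 x : 0 <= pairing x x.
Proof. by apply: sumr_ge0 => i _; rewrite -expr2 sqr_ge0. Qed.

Lemma pairing_eq0 x : pairing x x = 0 -> x = 0.
Proof.
move=> /eqP; rewrite psumr_eq0 => [/allP h|i _]; last by rewrite -expr2 sqr_ge0.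
apply/rowP => i; rewrite mxE; apply/eqP.
by have := h i (mem_index_enum _); rewrite mulf_eq0 orbb.
Qed.

Lemma pairing_gt0 x : x <> 0 -> 0 < pairing x x.
Proof.
by move=> x0; rewrite lt0r pairing_ge0 andbT; apply/eqP => /pairing_eq0.
Qed.

Lemma pairing_mulmx x y : pairing x y = (x *m y^T) 0 0.
Proof. by rewrite mxE; apply: eq_bigr => i _; rewrite mxE. Qed.

End Pairing.

(** * Farkas' lemma and biduality *)

(** Bartl's induction: either the first [n] inequalities already imply the
    conclusion, or some [w] satisfies them with [pairing g w < 0], and therefore
    [pairing (a n) w < 0]; projecting along [w] onto the kernel of [a n] then
    reduces to [n] functionals. *)
Lemma farkas (R : realType) (d n : nat) (a : nat -> 'rV[R]_d) (g : 'rV[R]_d) :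
  (forall y, (forall i, (i < n)%N -> 0 <= pairing (a i) y) ->
    0 <= pairing g y) ->
  exists2 c : nat -> R, forall i, 0 <= c i & g = \sum_(i < n) c i *: a i.
Proof.
elim: n a g => [|n IH] a g h.
  exists (fun=> 0) => //; rewrite big_ord0; apply: pairing_eq0.
  apply/eqP; rewrite eq_le pairing_ge0 andbT.
  by have := h (- g) (fun i => ltac:(done)); rewrite pairingNr oppr_ge0.
have [h'|] := pselect (forall y,
    (forall i, (i < n)%N -> 0 <= pairing (a i) y) -> 0 <= pairing g y).
  have [c c0 ->] := IH a g h'.
  exists (fun i => if i == n then 0 else c i) => [i|]; first by case: ifP.
  rewrite big_ord_recr /= eqxx scale0r addr0; apply: eq_bigr => i _.
  by rewrite ltn_eqF.
move=> /existsNP[w /not_implyP[w1 /negP]]; rewrite -ltNge => w2.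
have w3 : pairing (a n) w < 0.
  rewrite ltNge; apply/negP => w3; move: w2; rewrite ltNge => /negP; apply.
  by apply: h => i; rewrite ltnS leq_eqVlt => /orP[/eqP->//|/w1].
pose s v := pairing v w / pairing (a n) w.
pose pr y := y - (pairing (a n) y / pairing (a n) w) *: w.
have prE v y : pairing (v - s v *: a n) y = pairing v (pr y).
  by rewrite pairingBl pairingZl pairingBr pairingZr /s; ring.
have prn y : pairing (a n) (pr y) = 0.
  by rewrite pairingBr pairingZr divfK ?subrr// lt_eqF.
have [y hy|c c0 gE] := IH (fun i => a i - s (a i) *: a n) (g - s g *: a n).
  rewrite prE; apply: h => i; rewrite ltnS leq_eqVlt => /orP[/eqP->|/hy].
    by rewrite prn.
  by rewrite prE.
pose t := s g - \sum_(i < n) c i * s (a i).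
exists (fun i => if i == n then t else c i) => [i|].
  case: ifP => // _; rewrite /t -sumrN; apply: addr_ge0.
    by rewrite /s; apply: mulr_le0; [exact: ltW|rewrite invr_le0 ltW].
  apply: sumr_ge0 => j _; rewrite -mulrN; apply: mulr_ge0 => //.
  rewrite /s oppr_ge0; apply: mulr_ge0_le0; first exact: w1.
  by rewrite invr_le0 ltW.
rewrite big_ord_recr /= eqxx.
under eq_bigr do rewrite ltn_eqF//.
move/eqP: gE; rewrite subr_eq => /eqP-> /=.
under eq_bigr do rewrite scalerBr scalerA.
by rewrite sumrB -scaler_suml /t scalerBl -addrA [- _ + _]addrC.
Qed.

Lemma hyperplaneN1_0 (R : realType) (d : nat) (u : 'rV[R]_d) :
  ~ hyperplane u (-1) 0.
Proof.
rewrite /hyperplane /= pairing0l => /eqP.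
by rewrite eq_sym oppr_eq0 oner_eq0.
Qed.

Lemma pairing_row_mx (R : realType) (m n : nat) (x1 y1 : 'rV[R]_m)
    (x2 y2 : 'rV[R]_n) :
  pairing (row_mx x1 x2) (row_mx y1 y2) = pairing x1 y1 + pairing x2 y2.
Proof.
rewrite /pairing big_split_ord /=; congr (_ + _).
  by apply: eq_bigr => i _; rewrite !row_mxEl.
by apply: eq_bigr => i _; rewrite !row_mxEr.
Qed.

Section ConvexHull.
Context {R : realType} {d : nat}.
Implicit Types (A B P F G : set 'rV[R]_d) (x y u : 'rV[R]_d).

Lemma sub_convex_hull A : A `<=` convex_hull A.
Proof.
move=> x Ax; exists 1%N, (fun=> x), (fun=> 1).
by split=> //; rewrite big_ord1// scale1r.
Qed.

Lemma convex_hullS A B : A `<=` B -> convex_hull A `<=` convex_hull B.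
Proof.
move=> AB x [n [p [c [pA c0 c1 ->]]]].
by exists n, p, c; split=> // i; apply/AB.
Qed.

Lemma pairing_combr n (p : 'I_n -> 'rV[R]_d) (c : 'I_n -> R) u :
  pairing (\sum_i c i *: p i) u = \sum_i c i * pairing (p i) u.
Proof. by rewrite pairing_suml; under eq_bigr do rewrite pairingZl. Qed.

Lemma convex_hull_ge A u c : (forall a, A a -> c <= pairing a u) ->
  forall x, convex_hull A x -> c <= pairing x u.
Proof.
move=> h x [n [p [e [pA e0 e1 ->]]]]; rewrite pairing_combr.
rewrite -[c]mul1r -e1 mulr_suml; apply: ler_sum => i _.
by apply: ler_wpM2l => //; apply: h.
Qed.

(** The excess over the minimum is averaged with nonnegative weights, so it
    vanishes at each point of positive weight. *)
Lemma convex_hull_face A u c : (forall a, A a -> c <= pairing a u) ->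
  convex_hull A `&` hyperplane u c = convex_hull (A `&` hyperplane u c).
Proof.
move=> h; apply/seteqP.
split=> [x [[n [p [e [pA e0 e1 xE]]]] xc]|x hx]; last first.
  split; first by apply: convex_hullS hx => y [].
  apply/eqP; rewrite eq_le; apply/andP; split; last first.
    by apply: convex_hull_ge hx => a [/h].
  rewrite -lerN2 -pairingNr; apply: convex_hull_ge hx => a [_ <-].
  by rewrite pairingNr.
have z i : e i = 0 \/ pairing (p i) u = c.
  have : \sum_i e i * (pairing (p i) u - c) == 0.
    under eq_bigr do rewrite mulrBr.
    by rewrite sumrB -mulr_suml e1 mul1r -pairing_combr -xE xc subrr.
  rewrite psumr_eq0 => [/allP/(_ i (mem_index_enum _))|j _]; last first.
    by rewrite mulr_ge0// subr_ge0 h.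
  by rewrite mulf_eq0 subr_eq0 => /orP[]/eqP; [left|right].
have [j ej] : exists j, e j != 0.
  apply/not_existsP => h0; move: e1; rewrite big1.
    by move/eqP; rewrite eq_sym oner_eq0.
  by move=> i _; apply/eqP/negP => /negP/h0.
(* the points of weight 0 may lie off the hyperplane; [p j] stands in for them *)
exists n, (fun i => if e i == 0 then p j else p i), e; split=> // [i|].
  case: eqP => [_|ei]; split=> //.
    by have [e0j|//] := z j; rewrite e0j eqxx in ej.
  by have [|] := z i.
rewrite xE; apply: eq_bigr => i _.
by case: eqP => // ->; rewrite !scale0r.
Qed.

End ConvexHull.

Lemma dual_polytope_hull (R : realType) (d : nat) (A : set 'rV[R]_d) y :
  dual_polytope (convex_hull A) y <-> forall a, A a -> -1 <= pairing a y.
Proof.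
split=> h a Aa; first by apply: h; apply: sub_convex_hull.
exact: convex_hull_ge Aa.
Qed.

(** Homogenization: [x] is in the hull of the [a]'s when [(x, 1)] is in the cone
    over the [(a, 1)]'s.  A functional [(y, t)] that is nonnegative on that cone
    has [0 <= t], and it is nonnegative at [(x, 1)] because [t^-1 *: y] is in
    the dual, or, when [t = 0], because all multiples of [y] are. *)
Lemma dual_dual_polytope (R : realType) (d : nat) (P : set 'rV[R]_d) :
  polytope P -> P 0 -> dual_polytope (dual_polytope P) = P.
Proof.
move=> [A /finite_seqP[s ->]] PE P0.
apply/seteqP; split=> [x hx|x Px y]; last by rewrite pairingC => /(_ x Px).
pose one : 'rV[R]_1 := const_mx 1.
have oneE r : pairing one (const_mx r) = r.
  by rewrite /pairing big_ord1 !mxE mul1r.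
have [y'|c c0 cE] := @farkas R (d + 1) (size s)
    (fun i => row_mx s`_i one) (row_mx x one).
  rewrite -(hsubmxK y'); set y := lsubmx y'.
  have -> : rsubmx y' = const_mx (rsubmx y' 0 0).
    by apply/rowP => i; rewrite !mxE !ord1.
  set t := rsubmx y' 0 0; rewrite pairing_row_mx oneE.
  move=> h.
  have hP z : P z -> - t <= pairing z y.
    rewrite PE; apply: convex_hull_ge => a /= /(nthP 0)[i i1 <-].
    by have := h i i1; rewrite pairing_row_mx oneE; lra.
  have := hP 0 P0; rewrite pairing0l oppr_le0 le_eqVlt => /orP[/eqP t0|t0].
    rewrite -t0 addr0 leNgt; apply/negP => xy.
    have /hx : dual_polytope P (- (2 / pairing x y) *: y).
      move=> z /hP; rewrite -t0 oppr0 pairingZr => zy.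
      apply: (@le_trans _ _ 0); first by rewrite lerN10.
      by apply: mulr_ge0 => //; rewrite oppr_ge0 mulr_ge0_le0// invr_le0 ltW.
    rewrite pairingZl (pairingC y x) mulNr divfK ?lt_eqF//; lra.
  have /hx : dual_polytope P (t^-1 *: y).
    by move=> z /hP zy; rewrite pairingZr mulrC ler_pdivlMr// mulN1r.
  by rewrite pairingZl mulrC pairingC ler_pdivlMr// mulN1r; lra.
rewrite PE; exists (size s), (fun i => s`_i), (fun i => c i); split=> //.
- by move=> i; apply/mem_nth.
- have /(congr1 (fun v : 'rV[R]_(d + 1) => v 0 (rshift d 0))) := cE.
  rewrite row_mxEr summxE mxE => ->; apply: eq_bigr => i _.
  by rewrite mxE row_mxEr mxE mulr1.
- have /(congr1 (@lsubmx R 1 d 1)) := cE.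
  rewrite row_mxKl => ->; rewrite linear_sum; apply: eq_bigr => i _.
  by rewrite linearZ /= row_mxKl.
Qed.

(** * Faces of polytopes *)

(** Strict inequalities at finitely many points survive a perturbation of size
    [e]. *)
Lemma small_scale (R : realType) (T : eqType) (s : seq T) (f g : T -> R) :
  exists2 e : R, 0 < e & forall a, a \in s -> 0 < f a -> e * `|g a| < f a.
Proof.
elim: s => [|a s [e e0 he]]; first by exists 1.
have [fa|fa] := ltP 0 (f a); last first.
  exists e => // b; rewrite inE => /orP[/eqP->|/he//].
  by rewrite ltNge fa.
pose e' := f a / (1 + `|g a|).
have g0 : 0 < 1 + `|g a| by rewrite ltr_pwDl.
have e'0 : 0 < e' by rewrite divr_gt0.
exists (Num.min e e') => [|b]; first by rewrite lt_min e0.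
rewrite inE => /orP[/eqP->{b} _|bs fb].
  apply: (@le_lt_trans _ _ (e' * `|g a|)).
    by apply: ler_wpM2r => //; rewrite ge_min lexx orbT.
  by rewrite /e' mulrAC ltr_pdivrMr// ltr_pM2l// ltrDr.
apply: le_lt_trans (he b bs fb).
by apply: ler_wpM2r => //; rewrite ge_min lexx.
Qed.

Section Faces.
Context {R : realType} {d : nat}.
Implicit Types (P F G : set 'rV[R]_d) (x y u v : 'rV[R]_d).

Lemma faceS P F : face P F -> F `<=` P.
Proof. by move=> [u [c [_ ->]]] x []. Qed.

Lemma face_self P : face P P.
Proof.
exists 0, 0; split=> [x _|]; first by rewrite pairing0r.
apply/seteqP; split=> [x Px|x []//].
by split=> //; rewrite /hyperplane /= pairing0r.
Qed.

Lemma face_set0 P : face P set0.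
Proof.
exists 0, (-1); split=> [x _|]; first by rewrite pairing0r lerN10.
apply/seteqP; split=> // x [_]; rewrite /hyperplane /= pairing0r => /eqP.
by rewrite eq_sym oppr_eq0 oner_eq0.
Qed.

Lemma vertices_sub P : vertices P `<=` P.
Proof. by move=> v /faceS; apply. Qed.

Lemma faceI P F G : face P F -> face P G -> face P (F `&` G).
Proof.
move=> [u [c [uP ->]]] [w [c' [wP ->]]].
exists (u + w), (c + c'); split=> [x Px|].
  by rewrite pairingDr lerD ?uP ?wP.
apply/seteqP; split=> [x [[Px xu] [_ xw]]|x [Px]].
  by split=> //; rewrite /hyperplane /= pairingDr xu xw.
rewrite /hyperplane /= pairingDr => e.
have := uP x Px; have := wP x Px => ? ?.
by split; split=> //; rewrite /hyperplane /=; lra.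
Qed.

Lemma convex_hull_hyperplane A u (c : R) : A `<=` hyperplane u c ->
  convex_hull A `<=` @hyperplane R d u c.
Proof.
move=> h x; have -> : A = A `&` hyperplane u c by rewrite setIidl.
by rewrite -convex_hull_face => [[]//|a /h ->].
Qed.

(** If [F] minimizes [u] and [G] minimizes [w] within [F], then [G] minimizes
    [u + e *: w] as soon as [e] is so small that [w] cannot compensate for the
    excess of [u] at the finitely many generators outside [F]. *)
Lemma face_trans P F G : polytope P -> face P F -> face F G -> face P G.
Proof.
move=> [A /finite_seqP[s ->] PE] [u [c [uP FE]]] [w [c' [wF GE]]].
have [e e0 he] := small_scale s (fun a : 'rV[R]_d => pairing a u - c)
  (fun a => pairing a w - c').
have sP (a : 'rV[R]_d) : a \in s -> P a.
  by move=> ?; rewrite PE; apply: sub_convex_hull.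
pose t := c + e * c'.
have tE a : pairing a (u + e *: w) - t =
    (pairing a u - c) + e * (pairing a w - c').
  by rewrite pairingDr pairingZr /t; ring.
have cases (a : 'rV[R]_d) : a \in s ->
    (pairing a u = c /\ c' <= pairing a w) \/ t < pairing a (u + e *: w).
  move=> sa; have := uP a (sP a sa); rewrite le_eqVlt => /orP[/eqP ac|ac].
    by left; split=> //; apply: wF; rewrite FE; split; [exact: sP|].
  right; rewrite -subr_gt0 tE; have := he a sa; rewrite subr_gt0 => /(_ ac).
  rewrite -(gtr0_norm e0) -normrM => /ltr_normlP[]; rewrite gtr0_norm//.
  by lra.
have tP (a : 'rV[R]_d) : [set` s] a -> t <= pairing a (u + e *: w).
  move=> /cases[[ac aw]|/ltW//].
  by rewrite -subr_ge0 tE ac subrr add0r mulr_ge0 ?subr_ge0// ltW.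
exists (u + e *: w), t; split=> [x|].
  by rewrite PE; exact: convex_hull_ge.
apply/seteqP; split=> [x|x [Px xt]].
  rewrite GE FE => -[[Px xu] xw]; split=> //.
  by rewrite /hyperplane /= pairingDr pairingZr xu xw.
have sx : convex_hull ([set` s] `&` hyperplane (u + e *: w) t) x.
  by rewrite -convex_hull_face// -PE.
have sub (a : 'rV[R]_d) : ([set` s] `&` hyperplane (u + e *: w) t) a ->
    pairing a u = c /\ pairing a w = c'.
  rewrite /hyperplane /= => -[sa aT].
  have [[ac _]|] := cases a sa; last by rewrite aT ltxx.
  have := tE a; rewrite aT ac !subrr add0r => /esym/eqP.
  by rewrite mulf_eq0 gt_eqF//= subr_eq0 => /eqP.
have xu : hyperplane u c x.
  by apply: convex_hull_hyperplane sx => a /sub[].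
rewrite GE FE; split; first by split.
by apply: convex_hull_hyperplane sx => a /sub[].
Qed.

Lemma seq_argmin (T : eqType) (s : seq T) (Q : T -> Prop) (f : T -> R) a :
  a \in s -> Q a ->
  exists b, [/\ b \in s, Q b & forall c, c \in s -> Q c -> f b <= f c].
Proof.
elim: s a => [//|a0 s IH] a; rewrite inE => as_ Qa.
have [[b [bs Qb]]|] := pselect (exists b, b \in s /\ Q b).
  have [b' [b's Qb' hb]] := IH b bs Qb.
  have [[Qa0 le]|nle] := pselect (Q a0 /\ f a0 <= f b').
    exists a0; split; rewrite ?mem_head// => c.
    rewrite inE => /orP[/eqP->//|cs Qc].
    exact: le_trans le (hb c cs Qc).
  exists b'; split; rewrite ?inE ?b's ?orbT// => c /orP[/eqP-> Qa0|/hb//].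
  by rewrite leNgt; apply/negP => /ltW le; apply: nle.
move=> /forallNP nQ; have aE : a = a0.
  by case/orP: as_ => [/eqP//|sa]; case: (nQ a).
rewrite aE in Qa; exists a0; split; rewrite ?mem_head// => c.
by rewrite inE => /orP[/eqP->//|cs Qc]; case: (nQ c).
Qed.

Lemma face_generator P F (s : seq 'rV[R]_d) : P = convex_hull [set` s] ->
  face P F -> F = convex_hull ([set` s] `&` F).
Proof.
move=> PE [u [c [uP ->]]].
have sP : [set` s] `<=` P by rewrite PE; exact: sub_convex_hull.
by rewrite setIA (setIidl sP) {1}PE convex_hull_face// => a /sP /uP.
Qed.

Lemma convex_hull_nonempty (A : set 'rV[R]_d) :
  convex_hull A !=set0 -> A !=set0.
Proof.
move=> [x [n [p [c [pA _]]]]]; case: n p c pA => [|n] p c pA.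
  by rewrite big_ord0 => /eqP; rewrite eq_sym oner_eq0.
by exists (p ord0); apply: pA.
Qed.

Lemma min_face P F g : polytope P -> face P F -> F !=set0 ->
  exists m, [/\ face P (F `&` hyperplane g m), F `&` hyperplane g m !=set0 &
                forall x, F x -> m <= pairing x g].
Proof.
move=> hP fF F0; have [A /finite_seqP[s ->] PE] := hP.
have FE := face_generator PE fF.
have [a [sa Fa]] : [set` s] `&` F !=set0.
  by apply: convex_hull_nonempty; rewrite -FE.
have [b [sb Fb hb]] := seq_argmin (fun a => pairing a g) sa Fa.
have minF x : F x -> pairing b g <= pairing x g.
  by rewrite FE; apply: convex_hull_ge => c [sc Fc]; apply: hb.
exists (pairing b g); split=> //; last by exists b.
by apply: face_trans fF _ => //; exists g, (pairing b g).
Qed.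

(** A face that is not a single point has a smaller nonempty face: one that
    misses some generator of [P]. *)
Lemma face_vertex P F : polytope P -> face P F -> F !=set0 ->
  vertices P `&` F !=set0.
Proof.
move=> hP; have [A /finite_seqP[s ->] PE] := hP.
have [n] := ubnP (count (fun a => `[< F a >]) s).
elim: n F => [//|n IH] F; rewrite ltnS => le fF F0.
have FE := face_generator PE fF.
have [a [sa Fa]] : [set` s] `&` F !=set0.
  by apply: convex_hull_nonempty; rewrite -FE.
have [Fa1|] := pselect (F = [set a]).
  by exists a; split=> //; rewrite /vertices /= -Fa1.
move=> /eqP/eqP Fn; have [x Fx xa] : exists2 x, F x & x <> a.
  apply/not_exists2P => h; apply: Fn; apply/seteqP; split=> [x Fx|x ->//].
  by case: (h x) => // /contrapT.
have [m [fG G0 hm]] := min_face (a - x) hP fF F0.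
have [|v [vP [Fv _]]] := IH _ _ fG G0; last by exists v.
apply: leq_trans le.
have nGa : ~ (F `&` hyperplane (a - x) m) a.
  move=> [_ /= am]; have := hm x Fx; rewrite -am.
  rewrite leNgt => /negP; apply; rewrite -subr_gt0 -pairingBl.
  by apply: pairing_gt0 => /subr0_eq ax; apply: xa.
move: (sa) => /= {FE PE IH Fn}; elim: s sa => //= b s IHs _.
rewrite inE => /orP[/eqP<-|bs].
  rewrite (asboolF nGa) (asboolT Fa) add0n ltnS.
  by apply: sub_count => c /asboolP[Fc _]; apply/asboolP.
rewrite -addnS leq_add ?IHs//.
by case: asboolP => // -[Fb _]; rewrite asboolT.
Qed.

Lemma min_vertex P F g : polytope P -> face P F -> F !=set0 ->
  exists v, [/\ vertices P v, F v &
                forall x, F x -> pairing v g <= pairing x g].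
Proof.
move=> hP fF F0; have [m [fG G0 hm]] := min_face g hP fF F0.
have [v [vP [Fv vm]]] := face_vertex hP fG G0.
by exists v; split=> // x /hm; rewrite vm.
Qed.

End Faces.

(** * Polytopes in duality *)

(** Symmetric in [P] and [Q], so that a statement about faces of [P] is also one
    about faces of [Q].  It forces 0 to be interior to both. *)
Definition dual_pair (R : realType) (d : nat) (P Q : set 'rV[R]_d) : Prop :=
  [/\ polytope P, polytope Q, dual_polytope P = Q & dual_polytope Q = P].

(** The face of [P] dual to the point [y] of the dual polytope. *)
Definition dual_face (R : realType) (d : nat) (P : set 'rV[R]_d) y :=
  P `&` hyperplane y (-1).

Lemma dual_pairC (R : realType) (d : nat) (P Q : set 'rV[R]_d) :
  dual_pair P Q -> dual_pair Q P.
Proof. by case. Qed.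

Lemma dual_pair_absorbing (R : realType) (d : nat) (P Q : set 'rV[R]_d) u :
  dual_pair P Q -> exists2 e : R, 0 < e & P (e *: u).
Proof.
move=> [_ [A /finite_seqP[t ->] QE] _ PE].
have [e e0 he] := small_scale t (fun=> 1) (fun b : 'rV[R]_d => pairing b u).
exists e => //; rewrite -PE QE; apply/dual_polytope_hull => b /he/(_ ltr01).
rewrite pairingZr -(gtr0_norm e0) -normrM => /ltr_normlP[].
by rewrite gtr0_norm//; lra.
Qed.

Section DualPair.
Context {R : realType} {d : nat} {P Q : set 'rV[R]_d}.
Hypothesis PQ : dual_pair P Q.
Implicit Types (F G : set 'rV[R]_d) (x y u v b : 'rV[R]_d).

Lemma dual_pair_ge x y : P x -> Q y -> -1 <= pairing x y.
Proof. by case: PQ => _ _ <- _ Px; apply. Qed.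

Lemma dual_pair0 : P 0.
Proof. by case: PQ => _ _ _ <- y _; rewrite pairing0r lerN10. Qed.

Lemma face_dual_face y : Q y -> face P (dual_face P y).
Proof. by move=> Qy; exists y, (-1); split=> // x Px; apply: dual_pair_ge. Qed.

Lemma dual_face_proper y : dual_face P y <> P.
Proof.
by move=> E; have := dual_pair0; rewrite -E => -[_] /hyperplaneN1_0.
Qed.

(** The minimum [c] of [u] on [P] is negative, since [P] contains a multiple of
    [- u]; dividing [u] by [- c] normalizes it to -1. *)
Lemma proper_face F : face P F -> F !=set0 -> F <> P ->
  exists2 y, Q y & F = dual_face P y.
Proof.
move=> [u [c [uP FE]]] [x0 Fx0] FP.
have c0 : c <= 0 by have := uP 0 dual_pair0; rewrite pairing0l.
have {c0}c0 : c < 0.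
  rewrite lt_neqAle c0 andbT; apply/eqP => cE; apply: FP; rewrite FE.
  apply/setIidl => x Px; rewrite /hyperplane /= cE.
  have [e e0 /uP] := dual_pair_absorbing (- u) PQ.
  rewrite cE pairingZl pmulr_rge0// pairingNl oppr_ge0 => uu.
  rewrite (@pairing_eq0 _ _ u) ?pairing0r//.
  by apply/eqP; rewrite eq_le uu pairing_ge0.
have cN : 0 < - c by rewrite oppr_gt0.
exists ((- c)^-1 *: u).
  case: PQ => _ _ <- _ x /uP xu; rewrite pairingZr mulrC ler_pdivlMr//.
  by rewrite mulN1r opprK.
rewrite FE; congr (_ `&` _); apply/seteqP.
split=> x; rewrite /hyperplane /= pairingZr.
  by move=> ->; rewrite invrN mulNr mulVf// lt_eqF.
move=> /(congr1 ( *%R (- c))); rewrite mulrA divff ?gt_eqF// mul1r => ->.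
by rewrite mulrN1 opprK.
Qed.

(** The points of [Q] whose dual face contains that of [y] form a face of [Q],
    since they minimize the sum of the generators of [P] lying on the dual face of
    [y].  Any vertex of that face will do. *)
Lemma dual_face_sub_vertex y : Q y ->
  exists2 b, vertices Q b & dual_face P y `<=` dual_face P b.
Proof.
move=> Qy; case: (PQ) => -[A /finite_seqP[s ->] PE] hQ _ _.
have FE := face_generator PE (face_dual_face Qy).
set F := dual_face P y in FE *.
pose r := [seq a <- s | `[< F a >]].
have rF (a : 'rV[R]_d) : a \in r -> F a.
  by rewrite mem_filter => /andP[/asboolP].
pose w := \sum_(a <- r) a; pose m := \sum_(a <- r) (-1 : R).
have wE (z : 'rV[R]_d) : pairing z w - m = \sum_(a <- r) (pairing a z + 1).
  rewrite pairing_sumr -sumrB; apply: eq_bigr => a _.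
  by rewrite opprK pairingC.
have ge0 z a : Q z -> a \in r -> 0 <= pairing a z + 1.
  by move=> Qz /rF[Pa _]; have := dual_pair_ge Pa Qz; lra.
have fG : face Q (Q `&` hyperplane w m).
  exists w, m; split=> // z Qz; rewrite -subr_ge0 wE big_seq.
  by apply: sumr_ge0 => a; apply: ge0.
have GE z : Q z -> (hyperplane w m z <-> forall a, a \in r -> pairing a z = -1).
  move=> Qz; split=> [zw a ar|h].
    have /eqP := wE z; rewrite zw subrr eq_sym big_seq psumr_eq0.
      2: by move=> *; apply: ge0.
    by move=> /allP/(_ a ar); rewrite ar /= addr_eq0 => /eqP.
  apply/eqP; rewrite -subr_eq0 wE big_seq big1// => a /h ->.
  by rewrite addNr.
have [|b [vb [Qb /(GE b Qb) hb]]] := face_vertex hQ fG.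
  by exists y; split=> //; apply/GE => // a /rF[].
exists b => //; rewrite FE => x xF; split.
  by rewrite PE; apply: convex_hullS xF => a [].
apply: convex_hull_hyperplane xF => a [sa Fa]; apply: hb.
by rewrite mem_filter; apply/andP; split=> //; apply/asboolP.
Qed.

Lemma proper_face_sub F : face P F -> F !=set0 -> F <> P ->
  exists2 b, vertices Q b & F `<=` dual_face P b.
Proof.
move=> fF F0 FP; have [y Qy ->] := proper_face fF F0 FP.
exact: dual_face_sub_vertex.
Qed.

(** [P] is bounded: a small multiple of [- y] belongs to [Q]. *)
Lemma dual_pair_ray x y : (forall k : nat, P (x + k%:R *: y)) -> y = 0.
Proof.
move=> h; apply: contrapT => /pairing_gt0 y0.
have [e e0 Qe] := dual_pair_absorbing (- y) (dual_pairC PQ).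
have ey0 : 0 < e * pairing y y by rewrite mulr_gt0.
pose r := 1 - e * pairing x y.
have := archi_boundP (normr_ge0 (r / (e * pairing y y))).
set k := Num.bound _ => kr.
have := dual_pair_ge (h k) Qe; rewrite pairingZr pairingNr pairingDl pairingZl.
move: (le_lt_trans (ler_norm _) kr); rewrite ltr_pdivrMr// /r; lra.
Qed.

(** The minimum of the pairing with [x] on [Q] is attained at a vertex. *)
Lemma vertex_test x : P x <-> forall b, vertices Q b -> -1 <= pairing x b.
Proof.
split=> [Px b /vertices_sub|h]; first exact: dual_pair_ge.
case: (PQ) => _ hQ _ <- y Qy; rewrite pairingC.
have [|b [vb _ hb]] := min_vertex x hQ (face_self Q); first by exists y.
by rewrite pairingC; apply: le_trans (hb y Qy); rewrite pairingC; apply: h.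
Qed.

End DualPair.

(** * Affine hulls and facets *)

Section AffineHull.
Context {R : realType} {d : nat}.
Implicit Types (A B : set 'rV[R]_d) (x y u : 'rV[R]_d).

Lemma sub_affine_hull A : A `<=` affine_hull A.
Proof.
move=> x Ax; exists 1%N, (fun=> x), (fun=> 1).
by split=> //; rewrite big_ord1// scale1r.
Qed.

Lemma affine_hullS A B : A `<=` B -> affine_hull A `<=` affine_hull B.
Proof.
by move=> AB x [n [p [c [pA c1 ->]]]]; exists n, p, c; split=> // i; apply/AB.
Qed.

Lemma affine_hull_hyperplane A u (c : R) : A `<=` hyperplane u c ->
  affine_hull A `<=` @hyperplane R d u c.
Proof.
move=> h x [n [p [e [pA e1 ->]]]]; rewrite /hyperplane /= pairing_combr.
under eq_bigr do rewrite (h _ (pA _)).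
by rewrite -mulr_suml e1 mul1r.
Qed.

Lemma affine_hull_line A x y (t : R) : A x -> A y ->
  affine_hull A ((1 - t) *: x + t *: y).
Proof.
move=> Ax Ay; exists 2%N, (fun i => if i == 0 then x else y),
  (fun i => if i == 0 then 1 - t else t); split=> [i||].
- by case: ifP.
- by rewrite !big_ord_recl big_ord0/= addr0 subrK.
- by rewrite !big_ord_recl big_ord0/= addr0.
Qed.

Lemma affine_hull_rangeP n (p : 'I_n -> 'rV[R]_d) x :
  affine_hull (range p) x <->
  exists2 c : 'I_n -> R, \sum_i c i = 1 & x = \sum_i c i *: p i.
Proof.
split=> [[m [q [e [qp e1 ->]]]]|[c c1 ->]]; last first.
  by exists n, p, c; split=> // i; exists i.
have [j|f fE] := @boolp.choice _ _ (fun j i => p i = q j).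
  by have [i _ <-] := qp j; exists i.
exists (fun i => \sum_(j | f j == i) e j).
  by rewrite -e1 [RHS](partition_big f xpredT).
rewrite (partition_big f xpredT)//=; apply: eq_bigr => i _.
by rewrite scaler_suml; apply: eq_bigr => j /eqP<-; rewrite fE.
Qed.

Lemma mulmx_rows n (p : 'I_n -> 'rV[R]_d) (c : 'rV[R]_n) :
  c *m \matrix_i p i = \sum_i c 0 i *: p i.
Proof. by rewrite mulmx_sum_row; apply: eq_bigr => i _; rewrite rowK. Qed.

Lemma spanning_rows n (p : 'I_n -> 'rV[R]_d) :
  (forall u, (forall i, pairing (p i) u = 0) -> u = 0) ->
  row_full (\matrix_i p i).
Proof.
move=> h; rewrite /row_full -mxrank_tr; apply: inj_row_free => u /rowP hu.
apply: h => i; have := hu i; rewrite !mxE => <-.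
by rewrite pairingC; apply: eq_bigr => j _; rewrite !mxE.
Qed.

(** The family spans the space linearly, and is linearly dependent because 0 is
    an affine combination of it. *)
Lemma affine_hull_full n (p : 'I_n -> 'rV[R]_d) :
  affine_hull (range p) = setT -> (d < n)%N.
Proof.
move=> pT; have all x : affine_hull (range p) x by rewrite pT.
have /eqP full : row_full (\matrix_i p i).
  apply: spanning_rows => u hu; apply: pairing_eq0.
  have : affine_hull (range p) `<=` hyperplane u 0.
    by apply: affine_hull_hyperplane => _ [i _ <-]; apply: hu.
  by apply.
rewrite ltn_neqAle -{2}full rank_leq_row andbT; apply/eqP => dn.
have /affine_hull_rangeP[c c1 c0] := all 0.
have free : row_free (\matrix_i p i) by rewrite /row_free full dn.
have /(congr1 (mulmx^~ (1%:M))) := mulmx_rows p (\row_i c i).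
rewrite !mulmx1; under eq_bigr do rewrite mxE.
rewrite -c0 => /eqP; rewrite mulmx_free_eq0// => /eqP/rowP cE.
move: c1; rewrite big1 => [/eqP|i _]; first by rewrite eq_sym oner_eq0.
by have := cE i; rewrite !mxE.
Qed.

(** Pairing a linear relation with [u] shows that its coefficients sum to 0. *)
Lemma affinely_independent_free n (p : 'I_n -> 'rV[R]_d) u (c : R) : c != 0 ->
  (forall i, pairing (p i) u = c) -> affinely_independent p ->
  row_free (\matrix_i p i).
Proof.
move=> c0 pu ip; apply: inj_row_free => e; rewrite mulmx_rows => e0.
apply/rowP => i; rewrite mxE; apply: ip => //.
have /eqP := congr1 (fun x => pairing x u) e0; rewrite pairing_combr pairing0l.
under eq_bigr do rewrite pu.
by rewrite -mulr_suml mulf_eq0 (negPf c0) orbF => /eqP.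
Qed.

Lemma affine_hull_basis (p : 'I_d -> 'rV[R]_d) u (c : R) : c != 0 ->
  (forall i, pairing (p i) u = c) -> \matrix_i p i \in unitmx ->
  affine_hull (range p) = hyperplane u c.
Proof.
move=> c0 pu pU; apply/seteqP; split=> [|x xu].
  by apply: affine_hull_hyperplane => _ [i _ <-]; apply: pu.
apply/affine_hull_rangeP; pose e := x *m invmx (\matrix_i p i).
have xE : x = \sum_i e 0 i *: p i by rewrite -mulmx_rows mulmxKV.
exists (e 0) => //; apply: (mulIf c0); rewrite mul1r -[RHS]xu xE pairing_combr.
by rewrite mulr_suml; apply: eq_bigr => i _; rewrite pu.
Qed.

End AffineHull.

Section Facets.
Context {R : realType} {d : nat} {P Q : set 'rV[R]_d}.
Hypothesis PQ : dual_pair P Q.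
Implicit Types (F G : set 'rV[R]_d) (x y u v b : 'rV[R]_d).

Lemma affine_hull_dual_pair : affine_hull P = setT.
Proof.
apply/seteqP; split=> // x _.
have [e e0 Px] := dual_pair_absorbing x PQ.
have := affine_hull_line e^-1 (dual_pair0 PQ) Px.
by rewrite scaler0 add0r scalerA mulVf ?scale1r// gt_eqF.
Qed.

Lemma has_dim_dual_pair k : has_dim P k -> (d <= k)%N.
Proof.
by move=> [p _]; rewrite affine_hull_dual_pair => /esym/affine_hull_full.
Qed.

(** A vector orthogonal to the face dual to [b] could be added to [b] and
    subtracted from it, in a small multiple, without leaving [Q]. *)
Lemma vertex_dual_face_spanning b u : vertices Q b ->
  (forall x, dual_face P b x -> pairing x u = 0) -> u = 0.
Proof.
move=> vb hu; have Qb := vertices_sub vb.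
case: (PQ) => -[A /finite_seqP[s ->] PE] _ QE _.
have [e e0 he] := small_scale s (fun a : 'rV[R]_d => pairing a b + 1)
  (fun a => pairing a u).
have Qbu (r : R) : `|r| = e -> Q (b + r *: u).
  move=> re; rewrite -QE PE; apply/dual_polytope_hull => a sa.
  have Pa : P a by rewrite PE; apply: sub_convex_hull.
  have := dual_pair_ge PQ Pa Qb; rewrite le_eqVlt => /orP[/eqP ab|ab].
    by rewrite pairingDr pairingZr -ab hu ?mulr0 ?addr0//; split.
  have := he a sa; rewrite -[1]opprK subr_gt0 => /(_ ab).
  rewrite -re -normrM pairingDr pairingZr => /ltr_normlP[]; lra.
have [w [c [wQ bE]]] := vb.
have Eb x : [set b] x <-> (Q `&` hyperplane w c) x by rewrite -bE.
have /Eb[_] : [set b] b by []. rewrite /hyperplane /= => bw.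
have bu : pairing (e *: u) w = 0.
  have := wQ _ (Qbu e (gtr0_norm e0)).
  have := wQ _ (Qbu (- e) (etrans (normrN _) (gtr0_norm e0))).
  by rewrite scaleNr !pairingDl pairingNl; lra.
have : [set b] (b + e *: u).
  apply/Eb; split; first exact/Qbu/gtr0_norm.
  by rewrite /hyperplane /= pairingDl bu bw addr0.
move=> /(canRL (addKr _)); rewrite addNr => /eqP.
by rewrite scaler_eq0 gt_eqF// => /eqP.
Qed.

Lemma vertex_dual_face_basis b : vertices Q b ->
  exists2 p : 'I_d -> 'rV[R]_d, forall i, dual_face P b (p i) &
    \matrix_i p i \in unitmx.
Proof.
move=> vb; case: (PQ) => -[A /finite_seqP[s ->] PE] _ _ _.
have FE := face_generator PE (face_dual_face PQ (vertices_sub vb)).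
pose r : seq 'rV[R]_d := [seq a <- s | `[< dual_face P b a >]].
have rF a : a \in r -> dual_face P b a by rewrite mem_filter => /andP[/asboolP].
have full : row_full (\matrix_(i < size r) r`_i).
  apply: spanning_rows => u hu; apply: (vertex_dual_face_spanning vb) => x.
  rewrite FE; apply: convex_hull_hyperplane => a [sa Fa].
  have /(nthP 0)[i i1 <-] : a \in r.
    by rewrite mem_filter; apply/andP; split=> //; apply/asboolP.
  exact: (hu (Ordinal i1)).
exists (fun i => r`_(fullrankfun full i)); first by move=> i; apply/rF/mem_nth.
rewrite (_ : \matrix_i _ =
  rowsub (fullrankfun full) (\matrix_(i < size r) r`_i)).
  exact: fullrowsub_unit.
by apply/matrixP => i j; rewrite !mxE.
Qed.

Lemma dual_face_affine_hull b : vertices Q b ->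
  affine_hull (dual_face P b) = hyperplane b (-1).
Proof.
move=> vb; apply/seteqP; split; first by apply: affine_hull_hyperplane => x [].
have [p pF pU] := vertex_dual_face_basis vb.
rewrite -(affine_hull_basis (c := -1) (u := b) _ _ pU) ?oppr_eq0 ?oner_eq0//.
  2: by move=> i; have [] := pF i.
by apply: affine_hullS => _ [i _ <-].
Qed.

Lemma facet_dual_face b : (0 < d)%N -> vertices Q b -> facet P (dual_face P b).
Proof.
move=> d0 vb; split; first exact: face_dual_face (vertices_sub vb).
have [p pF pU] := vertex_dual_face_basis vb.
exists d.-1; rewrite ?prednK// /has_dim prednK//; exists p.
  move=> c _ c0 i; have /eqP := mulmx_rows p (\row_i c i).
  under eq_bigr do rewrite mxE.
  rewrite c0 mulmx_free_eq0 ?row_free_unit// => /eqP/rowP/(_ i).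
  by rewrite !mxE.
rewrite dual_face_affine_hull// (affine_hull_basis (c := -1) (u := b) _ _ pU)//.
by move=> i; have [] := pF i.
Qed.

(** A facet is the dual face of some [y] and lies in that of a vertex [b].  Its
    affine hull contains [d] affinely independent points.  They are linearly
    independent since [y] is -1 on them, and [b] is -1 on them too, so [y = b]. *)
Lemma facet_dual_faceP F : facet P F ->
  (0 < d)%N /\ exists2 b, vertices Q b & F = dual_face P b.
Proof.
move=> [fF [k dk [p ip pE]]]; split; first by rewrite dk.
have pF i : affine_hull F (p i) by rewrite pE; apply: sub_affine_hull; exists i.
have F0 : F !=set0.
  have [n [q [c [qF c1 _]]]] := pF ord0.
  case: n q c qF c1 => [|n] q c qF; last by exists (q ord0); apply: qF.
  by rewrite big_ord0 => /eqP; rewrite eq_sym oner_eq0.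
have FP : F <> P.
  move=> E; have : has_dim P k by rewrite -E; exists p.
  by move=> /has_dim_dual_pair; rewrite dk ltnn.
have [y Qy FE] := proper_face PQ fF F0 FP.
have [b vb yb] := dual_face_sub_vertex PQ Qy.
exists b => //; rewrite FE; congr dual_face; apply/subr0_eq.
have py i : pairing (p i) y = -1.
  by apply: affine_hull_hyperplane (pF i); rewrite FE => x [].
have pb i : pairing (p i) b = -1.
  by apply: affine_hull_hyperplane (pF i); rewrite FE => x /yb[].
have free : row_free (\matrix_i p i).
  by apply: affinely_independent_free py ip; rewrite oppr_eq0 oner_eq0.
have full : row_full (\matrix_i p i).
  by move: free; rewrite /row_free /row_full => /eqP->; apply/eqP.
apply/trmx_inj/(row_full_inj full); rewrite trmx0 mulmx0.
apply/colP => i; have h : pairing (p i) (y - b) = 0.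
  by rewrite pairingBr py pb subrr.
rewrite !mxE -[RHS]h.
by apply: eq_bigr => j _; rewrite !mxE.
Qed.

End Facets.

(** * The boundary *)

Section Boundary.
Context {R : realType} {d : nat} {P Q : set 'rV[R]_d}.
Hypothesis PQ : dual_pair P Q.
Implicit Types (x y u v b : 'rV[R]_d).

(** In dimension at least two a facet reduced to one point could not span the
    space; and the minimum on the facet of a functional that is not minimal at
    [x] is attained at a vertex other than [x]. *)
Lemma facet_other_vertex b x : (1 < d)%N -> vertices Q b -> dual_face P b x ->
  exists z, [/\ vertices P z, dual_face P b z & z <> x].
Proof.
move=> d1 vb Fx; have hP : polytope P by case: PQ.
have [[x' Fx' xx]|nx] := pselect (exists2 x', dual_face P b x' & x' <> x).
  have [|z [vz Fz /(_ x' Fx') hz]] :=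
    min_vertex (x - x') hP (face_dual_face PQ (vertices_sub vb)).
    by exists x.
  exists z; split=> // zx; move: hz; rewrite zx leNgt => /negP; apply.
  rewrite -subr_gt0 -pairingBl; apply: pairing_gt0 => /subr0_eq xE.
  exact: xx.
have : row_free x^T.
  apply: inj_row_free => u ux.
  apply: (vertex_dual_face_spanning PQ vb) => x' Fx'.
  have -> : x' = x by apply: contrapT => xx; apply: nx; exists x'.
  by rewrite pairingC pairing_mulmx ux mxE.
move=> /eqP rk; have := rank_leq_col x^T.
by rewrite rk leqNgt d1.
Qed.

Lemma continuous_pairing y : continuous (fun x => pairing x y).
Proof.
move=> x; apply: (cvg_big (U := R) (op := +%R) _ (F := nbhs x)) => [|i _].
  exact: add_continuous.
by apply: cvgM; [exact: coord_continuous|exact: cvg_cst].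
Qed.

Lemma closed_dual_pair : closed P.
Proof.
have -> : P = \bigcap_(y in Q) [set x | -1 <= pairing x y].
  apply/seteqP; split=> [x Px y Qy|x h] ; first exact (dual_pair_ge PQ Px Qy).
  by case: (PQ) => _ _ _ <- y Qy; rewrite pairingC; apply: h.
apply: closed_bigI => y _.
have /continuous_closedP := @continuous_pairing y.
by move=> /(_ [set r | -1 <= r]); apply; exact: closed_ge.
Qed.

(** An interior point can be multiplied by some [t > 1] within [P]. *)
Lemma interior_dual_pair x : interior P x -> forall y, Q y -> -1 < pairing x y.
Proof.
move=> ix y Qy.
have cx : (t *: x) @[t --> (1 : R)] --> x.
  by rewrite -[in X in _ --> X](scale1r x); apply: cvgZr_tmp; exact: cvg_id.
have nP : \forall t \near (1 : R)^'+, P (t *: x).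
  by apply: (cvg_at_right_filter cx).
have [t [Pt t1]] : exists t : R, P (t *: x) /\ 1 < t.
  have /filter_ex[t []] : \forall t \near (1 : R)^'+, P (t *: x) /\ 1 < t.
    by near=> t; split; near: t => //; exact: nbhs_right_gt.
  by exists t.
have := dual_pair_ge PQ Pt Qy; rewrite pairingZl.
have [|//] := leP (pairing x y) (-1) => xy.
by nra.
Unshelve. all: by end_near. Qed.

(** If no generator of [Q] is -1 at [x], then these finitely many functionals stay
    above -1 in a neighbourhood of [x], which is therefore contained in [P]. *)
Lemma boundary_dual_pair x :
  boundary P x <-> exists2 b, vertices Q b & dual_face P b x.
Proof.
rewrite /boundary -(closure_id _).1; last exact: closed_dual_pair.
split=> [[Px nix]|[b vb [Px xb]]]; last first.
  split=> // /interior_dual_pair/(_ b (vertices_sub vb)).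
  by rewrite xb ltxx.
apply: contrapT => nb; apply: nix.
case: (PQ) => _ [A /finite_seqP[t ->] QE] _ PE.
have gt b : b \in t -> -1 < pairing x b.
  move=> tb; have Qb : Q b by rewrite QE; apply: sub_convex_hull.
  rewrite lt_neqAle (dual_pair_ge PQ Px Qb) andbT; apply/eqP => xb; apply: nb.
  have [b' vb' sub] := dual_face_sub_vertex PQ Qb.
  by exists b' => //; apply: sub.
have : \forall z \near x, forall b, b \in t -> -1 < pairing z b.
  elim: {QE} t gt => [|b t IH] gt.
    by apply: (@nearW _ (nbhs x)) => z b; rewrite in_nil.
  have nb' : \forall z \near x, -1 < pairing z b.
    have cb := @continuous_pairing b x.
    by apply: (@cvgr_gt _ _ (nbhs x) _ _ _ cb _ (gt b (mem_head b t))).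
  have {}IH := IH (fun b' tb => gt b' (mem_behead (s := b :: t) tb)).
  apply: (@filterS2 _ (nbhs x)) nb' IH => z zb zt b'.
  by rewrite inE => /orP[/eqP->//|/zt].
apply: (@filterS _ (nbhs x)) => z hz; rewrite -PE QE.
apply/dual_polytope_hull => b tb.
by rewrite pairingC ltW// hz.
Qed.

End Boundary.

(** * Reflexive polytopes *)

Definition reflexive_pair (R : realType) (d : nat) (P Q : set 'rV[R]_d) :
    Prop :=
  [/\ dual_pair P Q, vertices P `<=` @lattice R d &
      vertices Q `<=` @lattice R d].

Lemma reflexive_pairC (R : realType) (d : nat) (P Q : set 'rV[R]_d) :
  reflexive_pair P Q -> reflexive_pair Q P.
Proof. by case=> /dual_pairC. Qed.

Lemma reflexive_polytope_pair (R : realType) (d : nat) (P : set 'rV[R]_d) :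
  reflexive_polytope P -> reflexive_pair P (dual_polytope P).
Proof.
move=> [[hP vP] _ P0 [hQ vQ]]; split=> //; split=> //.
by apply: dual_dual_polytope => //; apply: interior_subset.
Qed.

(** Lying on a common facet: in positive dimension the facets of [P] are the
    faces dual to the vertices of [Q]. *)
Definition cofacial (R : realType) (d : nat) (P Q : set 'rV[R]_d) x y :=
  exists b, [/\ vertices Q b, dual_face P b x & dual_face P b y].

Section Reflexive.
Context {R : realType} {d : nat} {P Q : set 'rV[R]_d}.
Hypothesis rPQ : reflexive_pair P Q.
Let PQ : dual_pair P Q. Proof. by case: rPQ. Qed.
Implicit Types (x y z u v b : 'rV[R]_d).
Local Notation lattice := (@lattice R d).

Lemma cofacialC x y : cofacial P Q x y -> cofacial P Q y x.
Proof. by move=> [b [vb xb yb]]; exists b. Qed.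

Lemma latticeD x y : lattice x -> lattice y -> lattice (x + y).
Proof. by move=> hx hy i; rewrite mxE rpredD. Qed.

Lemma lattice_pairing x y : lattice x -> lattice y -> pairing x y \is a Num.int.
Proof. by move=> hx hy; apply: rpred_sum => i _; rewrite rpredM. Qed.

(** The pairing with a vertex of the dual is an integer, so off the
    corresponding facet it is not only larger than -1 but nonnegative. *)
Lemma pairing_vertex_dual x b : lattice x -> P x -> vertices Q b ->
  dual_face P b x \/ 0 <= pairing x b.
Proof.
move=> lx Px vb; have lb : lattice b by case: rPQ => _ _; apply.
have := dual_pair_ge PQ Px (vertices_sub vb).
rewrite le_eqVlt => /orP[/eqP xb|]; first by left; split.
have /intrP[m xm] := lattice_pairing lx lb.
by rewrite /dual_face /hyperplane /= xm -[-1]/((-1)%:~R) ltr_int ler0z; right.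
Qed.

(** Otherwise all vertices of [Q] are nonnegative at [x], and [P] contains every
    multiple of [x]. *)
Lemma lattice_dual_face x : lattice x -> P x -> x <> 0 ->
  exists2 b, vertices Q b & dual_face P b x.
Proof.
move=> lx Px x0; apply: contrapT => nb; apply: x0.
apply: (dual_pair_ray PQ (x := 0)) => k; apply/(vertex_test PQ) => b vb.
rewrite add0r pairingZl; have [xb|xb] := pairing_vertex_dual lx Px vb.
  by case: (nb); exists b.
by apply: (@le_trans _ _ 0); rewrite ?lerN10 // mulr_ge0.
Qed.

Lemma lattice_addP x y : lattice x -> lattice y -> P x -> P y ->
  ~ cofacial P Q x y -> P (x + y).
Proof.
move=> lx ly Px Py nxy; apply/(vertex_test PQ) => b vb; rewrite pairingDl.
have [Fx|x0] := pairing_vertex_dual lx Px vb.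
  have [Fy|y0] := pairing_vertex_dual ly Py vb; first by case: nxy; exists b.
  by have := dual_pair_ge PQ Px (vertices_sub vb); lra.
by have := dual_pair_ge PQ Py (vertices_sub vb); lra.
Qed.

(** If [x] and [y] lie on no common facet, then so far as [x + k * y] and [y] do
    not either, the next point [x + (k + 1) * y] is in [P] again, and it stays on
    the facet [b] of [x], as [b] vanishes at [y].  This cannot go on forever,
    because [P] is bounded. *)
Lemma cofacial_ray x y b : lattice x -> lattice y -> P x -> P y ->
  vertices Q b -> dual_face P b x -> pairing y b = 0 -> y <> 0 ->
  exists z, [/\ lattice z, dual_face P b z & cofacial P Q z y].
Proof.
move=> lx ly Px Py vb Fx yb y0; apply: contrapT => /forallNP nz.
apply: y0; apply: (dual_pair_ray PQ (x := x)) => k.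
suff [] : lattice (x + k%:R *: y) /\ P (x + k%:R *: y) by [].
elim: k => [|k [lk Pk]]; first by rewrite scale0r addr0.
rewrite -natr1 scalerDl scale1r addrA; split; first exact: latticeD.
apply: lattice_addP => // c; apply: (nz (x + k%:R *: y)); split=> //.
split=> //; rewrite /hyperplane /= pairingDl pairingZl yb mulr0 addr0.
by case: Fx.
Qed.

Lemma cofacial_middle x y : lattice x -> lattice y -> P x -> P y ->
  x <> 0 -> y <> 0 -> y <> - x ->
  exists z, [/\ lattice z, cofacial P Q x z & cofacial P Q z y].
Proof.
move=> lx ly Px Py x0 y0 yx.
have [c|nc] := pselect (cofacial P Q x y).
  exists x; split=> //; have [b [vb Fx _]] := c.
  by exists b.
have [|||b vb [_ xyb]] := @lattice_dual_face (x + y).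
- exact: latticeD.
- exact: lattice_addP.
- by move=> /eqP; rewrite addrC addr_eq0 => /eqP.
rewrite /hyperplane /= pairingDl in xyb.
have [Fx|x0b] := pairing_vertex_dual lx Px vb.
  have yb : pairing y b = 0.
    by case: Fx => _; rewrite /hyperplane /=; clear x0 y0 yx; lra.
  have [z [lz Fz c]] := cofacial_ray lx ly Px Py vb Fx yb y0.
  by exists z; split=> //; exists b.
have [Fy|y0b] := pairing_vertex_dual ly Py vb.
  2: by have := addr_ge0 x0b y0b; rewrite xyb oppr_ge0 ler10.
have xb : pairing x b = 0.
  by case: Fy => _; rewrite /hyperplane /=; clear x0 y0 yx; lra.
have [z [lz Fz c]] := cofacial_ray ly lx Py Px vb Fy xb x0.
by exists z; split=> //; [exact: cofacialC|exists b].
Qed.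

(** The two facets through the middle point of [cofacial_middle] intersect in a
    nonempty face, and any vertex of it can replace that point. *)
Lemma cofacial_middle_vertex x y : lattice x -> lattice y -> P x -> P y ->
  x <> 0 -> y <> 0 -> y <> - x ->
  exists z, [/\ vertices P z, cofacial P Q x z & cofacial P Q z y].
Proof.
move=> lx ly Px Py x0 y0 yx.
have [z [_ [b [vb xb zb]] [c [vc zc yc]]]] :=
  cofacial_middle lx ly Px Py x0 y0 yx.
have hP : polytope P by case: PQ.
have fb := face_dual_face PQ (vertices_sub vb).
have fc := face_dual_face PQ (vertices_sub vc).
have [|v [vv [vFb vFc]]] := face_vertex hP (faceI fb fc); first by exists z.
by exists v; split=> //; [exists b|exists c].
Qed.

Lemma vertex_neq0 v : (0 < d)%N -> vertices P v -> v <> 0.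
Proof.
move=> d0 vP v0; have [e e0 Pe] := dual_pair_absorbing (const_mx 1) PQ.
have ne : e *: const_mx 1 <> 0 :> 'rV[R]_d.
  move=> /rowP/(_ (Ordinal d0)); rewrite !mxE mulr1 => eE.
  by rewrite eE ltxx in e0.
have [||b vb sub] := proper_face_sub PQ vP; first by exists v.
  by move=> E; move: Pe; rewrite -E v0.
by have [_] := sub v erefl; rewrite v0 => /hyperplaneN1_0.
Qed.

(** This also holds in dimension 0, where the boundary is empty and 0 is the only
    point. *)
Lemma gvert_facet_graph x :
  gvert (facet_graph P) x <-> [/\ lattice x, P x & x <> 0].
Proof.
split=> [[/(boundary_dual_pair PQ)[b vb [Px xb]] lx]|[lx Px x0]].
  by split=> // x0; move: xb; rewrite x0 => /hyperplaneN1_0.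
split=> //; apply/(boundary_dual_pair PQ).
exact: lattice_dual_face.
Qed.

Lemma gvert_vertex v : (0 < d)%N -> vertices P v -> gvert (facet_graph P) v.
Proof.
move=> d0 vv; apply/gvert_facet_graph; split; last exact: vertex_neq0.
  by case: rPQ => _ h _; apply: h.
exact: vertices_sub.
Qed.

Lemma cofacial_dim x y : cofacial P Q x y -> (0 < d)%N.
Proof.
move=> [b [_ [_ xb] _]]; rewrite lt0n; apply/eqP => d0; move: xb.
by rewrite (rV_dim0 x 0 d0) => /hyperplaneN1_0.
Qed.

Lemma gadj_facet_graph x y :
  gvert (facet_graph P) x -> gvert (facet_graph P) y ->
  (gadj (facet_graph P) x y <-> x <> y /\ cofacial P Q x y).
Proof.
move=> gx gy; split=> [[_ _ xy [F [fF Fx Fy]]]|[xy c]].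
  split=> //; have [_ [b vb FE]] := facet_dual_faceP PQ fF.
  by exists b; rewrite -FE.
have d0 := cofacial_dim c; have [b [vb bx bY]] := c.
split=> //; exists (dual_face P b); split=> //.
exact (facet_dual_face PQ d0 vb).
Qed.

Definition vertex_graph := induced_subgraph (facet_graph P) (vertices P).

Lemma gadj_vertex_graph x y :
  gadj vertex_graph x y <->
  [/\ vertices P x, vertices P y, x <> y & cofacial P Q x y].
Proof.
split=> [[vx vy a]|[vx vy xy c]].
  have [gx gy _ _] := a.
  by have [xy c] := (gadj_facet_graph gx gy).1 a.
have d0 := cofacial_dim c.
by split=> //; apply/gadj_facet_graph => //; exact: gvert_vertex.
Qed.

(** Common facets are visible in the face lattice, as every proper nonempty face
    is contained in a facet. *)
Lemma cofacial_face x y : cofacial P Q x y <->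
  exists F, [/\ face P F, F <> P, F x & F y].
Proof.
split=> [[b [vb bx bY]]|[F [fF FP Fx Fy]]].
  exists (dual_face P b); split=> //.
    exact: face_dual_face (vertices_sub vb).
  exact: (dual_face_proper PQ).
have [|b vb sub] := proper_face_sub PQ fF _ FP; first by exists x.
by exists b; split=> //; apply: sub.
Qed.

End Reflexive.
Arguments vertex_graph {R d} P.

(** * Distances in the graphs *)

Section Distance.
Context {R : realType} {d : nat} (G : graph 'rV[R]_d).

Lemma gdist_walk m n x y : (m <= n)%N -> walk G m x y ->
  (gdist R G x y <= (n%:R)%:E)%E.
Proof.
move=> mn w; apply: (@le_trans _ _ (m%:R)%:E); last by rewrite lee_fin ler_nat.
by apply: ereal_inf_lbound; exists m.
Qed.

Lemma walk_prepend n x z y : gvert G x -> x = z \/ gadj G x z ->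
  (exists2 m, (m <= n)%N & walk G m z y) ->
  exists2 m, (m <= n.+1)%N & walk G m x y.
Proof.
move=> gx [->|a] [m mn w]; first by exists m => //; apply: leqW.
by exists m.+1 => //; exists z.
Qed.

(** The combinatorial core common to both graphs.  The second hypothesis leaves out
    [x = - x] because in dimension 0 the only vertex is the origin, which has no
    neighbour. *)
Lemma antipodal_diameter_three :
  (forall x y, gvert G x -> gvert G y -> y <> - x ->
    exists z, [/\ gvert G z, x = z \/ gadj G x z & z = y \/ gadj G z y]) ->
  (forall x, gvert G x -> x <> - x ->
    exists z, [/\ gvert G z, gadj G x z & z <> x]) ->
  [/\ forall x y, gvert G x -> gvert G y -> (gdist R G x y <= 3%:E)%E,
      forall x y, gvert G x -> gvert G y -> gdist R G x y = 3%:E -> y = - x &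
      (gdiam R G <= 3%:E)%E].
Proof.
move=> middle neighbour.
have walk2 x y : gvert G x -> gvert G y -> y <> - x ->
    exists2 m, (m <= 2)%N & walk G m x y.
  move=> gx gy /(middle _ _ gx gy)[z [gz xz zy]].
  by do 2![apply: walk_prepend; eauto]; exists 0%N.
have dist3 x y : gvert G x -> gvert G y -> (gdist R G x y <= 3%:E)%E.
  move=> gx gy; suff [m m3 w] : exists2 m, (m <= 3)%N & walk G m x y.
    exact: gdist_walk w.
  have [yx|] := pselect (y = - x); last first.
    by move=> /(walk2 _ _ gx gy)[m m2]; exists m => //; apply: leqW.
  have [xx|/(neighbour _ gx)[z [gz xz zx]]] := pselect (x = - x).
    by exists 0%N => //; split=> //; rewrite yx.
  apply: walk_prepend (or_intror xz) _ => //; apply: walk2 => // yz.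
  by apply: zx; apply: oppr_inj; rewrite -yz -yx.
split=> // [x y gx gy d3|].
  apply: contrapT => /(walk2 _ _ gx gy)[m m2 w].
  by have := gdist_walk m2 w; rewrite d3 lee_fin ler_nat.
by apply: ge_ereal_sup => _ [x gx [y gy <-]]; apply: dist3.
Qed.

End Distance.

Section ReflexiveGraphs.
Context {R : realType} {d : nat} {P Q : set 'rV[R]_d}.
Hypothesis rPQ : reflexive_pair P Q.
Let PQ : dual_pair P Q. Proof. by case: rPQ. Qed.
Hypothesis d_neq1 : d <> 1%N.
Implicit Types (x y : 'rV[R]_d).

Lemma dim_gt1 x : x <> - x -> (1 < d)%N.
Proof.
move=> xx; rewrite ltn_neqAle eq_sym; apply/andP; split; first exact/eqP.
by rewrite lt0n; apply/eqP => d0; apply: xx; apply: rV_dim0.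
Qed.

Lemma cofacial_other_vertex x b :
  (1 < d)%N -> vertices Q b -> dual_face P b x ->
  exists z, [/\ vertices P z, cofacial P Q x z & z <> x].
Proof.
move=> d1 vb Fx; have [z [vz Fz zx]] := facet_other_vertex PQ d1 vb Fx.
by exists z; split=> //; exists b.
Qed.

Lemma facet_graph_diameter :
  let W := facet_graph P in
  [/\ forall x y, gvert W x -> gvert W y -> (gdist R W x y <= 3%:E)%E,
      forall x y, gvert W x -> gvert W y -> gdist R W x y = 3%:E -> y = - x &
      (gdiam R W <= 3%:E)%E].
Proof.
have step x y : gvert (facet_graph P) x -> gvert (facet_graph P) y ->
    cofacial P Q x y -> x = y \/ gadj (facet_graph P) x y.
  move=> gx gy c; have [|xy] := pselect (x = y); first by left.
  by right; apply/(gadj_facet_graph rPQ).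
apply: antipodal_diameter_three => [x y gx gy yx|x gx xx].
  have /(gvert_facet_graph rPQ)[lx Px x0] := gx.
  have /(gvert_facet_graph rPQ)[ly Py y0] := gy.
  have [z [vz xz zy]] := cofacial_middle_vertex rPQ lx ly Px Py x0 y0 yx.
  have gz := gvert_vertex rPQ (cofacial_dim xz) vz.
  by exists z; split=> //; apply: step.
have d1 := dim_gt1 xx; have [/(boundary_dual_pair PQ)[b vb Fx] _] := gx.
have [z [vz xz zx]] := cofacial_other_vertex d1 vb Fx.
have gz := gvert_vertex rPQ (cofacial_dim xz) vz.
by exists z; split=> //; have [xE|//] := step _ _ gx gz xz; case: zx.
Qed.

Lemma vertex_graph_diameter :
  let WV := vertex_graph P in
  [/\ forall x y, vertices P x -> vertices P y -> (gdist R WV x y <= 3%:E)%E,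
      forall x y, vertices P x -> vertices P y ->
        gdist R WV x y = 3%:E -> y = - x &
      (gdiam R WV <= 3%:E)%E].
Proof.
have step x y : vertices P x -> vertices P y ->
    cofacial P Q x y -> x = y \/ gadj (vertex_graph P) x y.
  move=> gx gy c; have [|xy] := pselect (x = y); first by left.
  by right; apply/(gadj_vertex_graph rPQ).
apply: (@antipodal_diameter_three _ _ (vertex_graph P));
  [move=> x y vx vy yx|move=> x vx xx].
  have [d0|d0] := posnP d.
    by case: yx; apply: rV_dim0.
  have /(gvert_facet_graph rPQ)[lx Px x0] := gvert_vertex rPQ d0 vx.
  have /(gvert_facet_graph rPQ)[ly Py y0] := gvert_vertex rPQ d0 vy.
  have [z [vz xz zy]] := cofacial_middle_vertex rPQ lx ly Px Py x0 y0 yx.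
  by exists z; split=> //; apply: step.
have d1 := dim_gt1 xx.
have [/(boundary_dual_pair PQ)[b vb Fx] _] := gvert_vertex rPQ (ltnW d1) vx.
have [z [vz xz zx]] := cofacial_other_vertex d1 vb Fx.
by exists z; split=> //; have [xE|//] := step _ _ vx vz xz; case: zx.
Qed.

End ReflexiveGraphs.

(** * Edges of simplicial polytopes *)

Section Simplices.
Context {R : realType} {d : nat}.
Implicit Types (P F : set 'rV[R]_d) (x y u : 'rV[R]_d).

Lemma affine_hull_range_sub n (p : 'I_n -> 'rV[R]_d) A :
  A `<=` affine_hull (range p) -> affine_hull A `<=` affine_hull (range p).
Proof.
move=> Ap x [m [q [c [qA c1 ->]]]].
have [j|e eE] := @boolp.choice _ _ (fun j (e : 'I_n -> R) =>
    \sum_i e i = 1 /\ q j = \sum_i e i *: p i).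
  by have /Ap/affine_hull_rangeP[e e1 ->] := qA j; exists e.
apply/affine_hull_rangeP; exists (fun i => \sum_j c j * e j i).
  rewrite exchange_big -c1 /=; apply: eq_bigr => j _.
  by rewrite -mulr_sumr (eE j).1 mulr1.
under [RHS]eq_bigr do rewrite scaler_suml.
rewrite exchange_big; apply: eq_bigr => j _ /=.
by rewrite {1}(eE j).2 scaler_sumr; apply: eq_bigr => i _; rewrite scalerA.
Qed.

Lemma convex_hull_affine_hull (A : set 'rV[R]_d) :
  convex_hull A `<=` affine_hull A.
Proof. by move=> x [n [p [c [pA _ c1 ->]]]]; exists n, p, c. Qed.

Lemma vertex_generator P (A : set 'rV[R]_d) x : vertices P x -> A `<=` P ->
  convex_hull A x -> A x.
Proof.
move=> [u [c [uP xE]]] AP Ax.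
have AuP a : A a -> c <= pairing a u by move/AP/uP.
have [|a [Aa ac]] := @convex_hull_nonempty _ _ (A `&` hyperplane u c).
  exists x; rewrite -convex_hull_face//; split=> //.
  by have : [set x] x by []; rewrite xE => -[].
suff : [set x] a by move=> <-.
by rewrite xE; split=> //; apply: AP.
Qed.

(** A functional vanishing exactly at [x] and [y] among the vertices of the
    simplex cuts out the edge between them. *)
Lemma simplex_edge F x y u : simplex F -> F `<=` hyperplane u (-1) ->
  vertices F x -> vertices F y -> x <> y ->
  exists E, [/\ face F E, has_dim E 1, E x & E y].
Proof.
move=> [n [p [ip FE]]] Fu vx vy xy.
have pF : range p `<=` F by rewrite FE; apply: sub_convex_hull.
have [i _ ix] : range p x.
  by apply: (vertex_generator vx pF); rewrite -FE; apply: vertices_sub vx.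
have [j _ jy] : range p y.
  by apply: (vertex_generator vy pF); rewrite -FE; apply: vertices_sub vy.
have /row_freeP[B pB] : row_free (\matrix_i p i).
  apply: (affinely_independent_free (c := -1) (u := u)) => // k.
  by apply: Fu; apply: pF; exists k.
pose h : 'cV[R]_n := \col_k (if (k == i) || (k == j) then 0 else 1).
pose g := (B *m h)^T.
have pg k : pairing (p k) g = if (k == i) || (k == j) then 0 else 1.
  transitivity ((\matrix_i p i *m (B *m h)) k 0).
    by rewrite mxE; apply: eq_bigr => l _; rewrite !mxE.
  by rewrite mulmxA pB mul1mx mxE.
have g0 a : range p a -> 0 <= pairing a g.
  by move=> [k _ <-]; rewrite pg; case: ifP.
pose E := F `&` hyperplane g 0; exists E.
have EE : E = convex_hull (range p `&` hyperplane g 0).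
  by rewrite /E FE convex_hull_face.
have Ex : E x.
  split; first exact: vertices_sub vx.
  by rewrite /hyperplane /= -ix pg eqxx.
have Ey : E y.
  split; first exact: vertices_sub vy.
  by rewrite /hyperplane /= -jy pg eqxx orbT.
split=> //.
  exists g, 0; split=> // a; rewrite FE; exact: convex_hull_ge.
pose q (k : 'I_2) := if k == 0 then x else y.
exists q.
  move=> c; rewrite !big_ord_recl !big_ord0 /= !addr0 => c0 cq.
  have c1 : c (lift ord0 ord0) = - c ord0.
    by apply/eqP; rewrite -addr_eq0 addrC c0.
  have c00 : c ord0 = 0.
    move: cq; rewrite c1 scaleNr -scalerBr => /eqP; rewrite scaler_eq0.
    by move=> /orP[/eqP//|]; rewrite subr_eq0 => /eqP.
  move=> k; have [->//|k1] := eqVneq k ord0.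
  suff -> : k = lift ord0 ord0 by rewrite c1 c00 oppr0.
  by apply/val_inj; case: k k1 => -[|[]].
apply/seteqP; split.
  apply: affine_hull_range_sub; rewrite EE => z /convex_hull_affine_hull.
  apply: affine_hull_range_sub => _ [[k _ <-]].
  rewrite /hyperplane /= pg; case: ifP => [|_ /eqP]; last by rewrite oner_eq0.
  move=> /orP[]/eqP-> _; apply: sub_affine_hull.
    by exists ord0 => //; rewrite /q eqxx.
  by exists (lift ord0 ord0).
apply: affine_hullS => _ [k _ <-].
by rewrite /q; case: ifP.
Qed.

End Simplices.

Lemma vertices_face (R : realType) (d : nat) (P F : set 'rV[R]_d) x :
  F `<=` P -> vertices P x -> F x -> vertices F x.
Proof.
move=> FP [u [c [uP xE]]] Fx; exists u, c; split=> [z /FP/uP//|].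
apply/seteqP; split=> [_ ->|z [/FP Pz zc]]; last by rewrite xE.
by split=> //; have : [set x] x by []; rewrite xE => -[].
Qed.

Lemma simplicial_edge_graph (R : realType) (d : nat) (P Q : set 'rV[R]_d) :
  reflexive_pair P Q -> d <> 1%N -> simplicial P ->
  vertex_graph P = edge_graph P.
Proof.
move=> rPQ d1 sP; have PQ : dual_pair P Q by case: rPQ.
congr Graph; apply/funext => x; apply/funext => y; apply/propext.
apply: (iff_trans (gadj_vertex_graph rPQ x y)).
split=> -[vx vy xy h]; split=> //.
  have d0 := cofacial_dim h; have [b [vb Fx Fy]] := h.
  have fF := facet_dual_face PQ d0 vb.
  have fP := faceS fF.1.
  have [|||E [fE dE Ex Ey]] := @simplex_edge _ _ _ x y b (sP _ fF) _ _ _ xy.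
  - by move=> z [].
  - exact: vertices_face fP vx Fx.
  - exact: vertices_face fP vy Fy.
  by exists E; split=> //; apply: face_trans fF.1 fE; case: PQ.
apply/(cofacial_face rPQ); have [E [fE dE Ex Ey]] := h.
exists E; split=> // EP; rewrite EP in dE.
have := has_dim_dual_pair PQ dE; rewrite leq_eqVlt => /orP[/eqP//|].
by rewrite ltnS leqn0 => /eqP d0; apply: xy; apply: rV_dim0.
Qed.

(** * Combinatorial invariance *)

(** Vertices are the atoms of the face lattice, and [cofacial_face] describes
    adjacency in terms of the faces containing two of them. *)
Lemma combinatorial_vertex_graph (R : realType) (d e : nat)
    (P P' : set 'rV[R]_d) (Q Q' : set 'rV[R]_e) :
  reflexive_pair P P' -> reflexive_pair Q Q' ->
  combinatorially_equivalent P Q ->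
  graph_isomorphic (vertex_graph P) (vertex_graph Q).
Proof.
move=> rP rQ [phi [phiF phiI phiS] phiM].
have phi_inj F G : face P F -> face P G -> phi F = phi G -> F = G.
  by move=> fF fG; apply: phiI; rewrite inE.
have hP : polytope P by case: rP => -[].
have hQ : polytope Q by case: rQ => -[].
have phi0 : phi set0 = set0.
  have [F fF F0] := phiS _ (face_set0 Q).
  apply/seteqP; split=> //; rewrite -F0.
  by apply/phiM => //; exact: face_set0.
have phiP : phi P = Q.
  have [F fF FQ] := phiS _ (face_self Q).
  apply/seteqP; split; first exact: faceS (phiF _ (face_self P)).
  by rewrite -FQ; apply/phiM => //; [exact: face_self|exact: faceS].
have phi_nonempty F : face P F -> F !=set0 -> phi F !=set0.
  move=> fF; rewrite -!set0P => /eqP F0; apply/eqP => E; apply: F0.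
  by apply: phi_inj => //; [exact: face_set0|rewrite E phi0].
have phiV v : vertices P v -> exists2 w, vertices Q w & phi [set v] = [set w].
  move=> vv; have [|w [vw wphi]] := face_vertex hQ (phiF _ vv).
    by apply: phi_nonempty => //; exists v.
  exists w => //; have [G fG GE] := phiS _ vw.
  rewrite -GE; congr phi.
  have Gv : G `<=` [set v] by apply/phiM => //; rewrite GE => _ ->.
  apply/esym/seteqP; split=> // _ ->.
  have : G !=set0.
    rewrite -set0P; apply/eqP => G0; move: GE; rewrite G0 phi0.
    by move=> /seteqP[_ /(_ w erefl)].
  by move=> [z Gz]; have <- := Gv z Gz.
pose f v := xget 0 (phi [set v]).
have fE v : vertices P v -> phi [set v] = [set f v].
  move=> /phiV[w _ E]; rewrite /f E; congr [set _].
  by case: xgetP => [z _ ->//|/(_ w)]; case.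
have fV v : vertices P v -> vertices Q (f v).
  by move=> vv; rewrite /vertices /= -fE//; apply: phiF.
have f_inj v v' : vertices P v -> vertices P v' -> f v = f v' -> v = v'.
  move=> vv vv' E; have /seteqP[/(_ v erefl)] : [set v] = [set v'].
    by apply: phi_inj => //; rewrite !fE// E.
  by [].
have sub1 v F : vertices P v -> face P F -> (F v <-> phi F (f v)).
  move=> vv fF; have := phiM _ _ vv fF; rewrite fE// => sub; split=> [Fv|pFv].
    by apply: sub.1 => // _ ->.
  by apply: sub.2 => // _ ->.
exists f.
  split=> [v|v v'|w vw] /=; first exact: fV.
    by rewrite !inE; apply: f_inj.
  have [G fG GE] := phiS _ vw.
  have [|v [vv Gv]] := face_vertex hP fG.
    rewrite -set0P; apply/eqP => G0; move: GE; rewrite G0 phi0.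
    by move=> /seteqP[_ /(_ w erefl)].
  by exists v => //; have := (sub1 v G vv fG).1 Gv; rewrite GE.
move=> x y vx vy.
apply: (iff_trans (gadj_vertex_graph rP x y)).
apply: iff_trans (iff_sym (gadj_vertex_graph rQ (f x) (f y))).
split=> -[_ _ xy].
  move=> /(cofacial_face rP)[F [fF FP Fx Fy]]; split; [exact: fV|exact: fV| |].
    by move=> /f_inj E; apply: xy; apply: E.
  apply/(cofacial_face rQ); exists (phi F); split; first exact: phiF.
  - by rewrite -phiP => /phi_inj E; apply: FP; apply: E => //; exact: face_self.
  - exact/sub1.
  - exact/sub1.
move=> /(cofacial_face rQ)[G [fG GQ Gx Gy]].
split=> //; first by move=> E; rewrite E in xy.
have [F fF FG] := phiS _ fG; rewrite -FG in Gx Gy GQ.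
apply/(cofacial_face rP); exists F; split=> //.
- by move=> FP; apply: GQ; rewrite FP.
- exact/sub1.
- exact/sub1.
Qed.

(** * Pairs of facets *)

(** The facets of [P] are the vertices of the dual polytope, and those meet in a
    vertex of [P] exactly when they lie on a common facet of the dual. *)
Lemma facet_trichotomy (R : realType) (d : nat) (P Q F G : set 'rV[R]_d) :
  reflexive_pair P Q -> facet P F -> facet P G ->
  [\/ parallel F G,
      exists v, [/\ vertices P v, F v & G v] |
      exists H, [/\ facet P H, H <> F, H <> G,
                    F `&` H !=set0 & G `&` H !=set0]].
Proof.
move=> rPQ; have PQ : dual_pair P Q by case: rPQ.
move=> /(facet_dual_faceP PQ)[d0 [b vb FE]].
move=> /(facet_dual_faceP PQ)[_ [c vc GE]].
have rQP := reflexive_pairC rPQ.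
have [cb|cb] := pselect (c = - b).
  apply: Or31; exists b; split; first exact/eqP/(vertex_neq0 rQP d0 vb).
  exists (-1), 1; rewrite FE GE !(dual_face_affine_hull PQ)//; split=> //.
  rewrite cb; apply/seteqP; split=> x; rewrite /hyperplane /= pairingNr.
    by move=> /oppr_inj.
  by move=> ->.
have [m|nm] := pselect (exists v, [/\ vertices P v, F v & G v]).
  exact: Or32.
apply: Or33.
have /(gvert_facet_graph rQP)[lb Qb b0] := gvert_vertex rQP d0 vb.
have /(gvert_facet_graph rQP)[lc Qc c0] := gvert_vertex rQP d0 vc.
have [h [vh [v [vv [_ vb1] [_ vh1]]] [w [vw [_ wh1] [_ wc1]]]]] :=
  cofacial_middle_vertex rQP lb lc Qb Qc b0 c0 cb.
have mem (z a : 'rV[R]_d) :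
    vertices P z -> hyperplane z (-1) a -> dual_face P a z.
  move=> /vertices_sub Pz; rewrite /hyperplane /= => az.
  by split=> //; rewrite /hyperplane /= pairingC.
have [Fv Hv] := (mem v b vv vb1, mem v h vv vh1).
have [Hw Gw] := (mem w h vw wh1, mem w c vw wc1).
exists (dual_face P h); split.
- exact (facet_dual_face PQ d0 vh).
- by move=> HF; apply: nm; exists w; rewrite -HF GE.
- by move=> HG; apply: nm; exists v; rewrite -HG FE.
- by exists v; rewrite FE.
- by exists w; rewrite GE.
Qed.

Theorem corollary3p2 (R : realType) (d : nat) (P : set 'rV[R]_d)
    (hP : reflexive_polytope P) :
  let W := facet_graph P in
  let WV := induced_subgraph W (vertices P) in
  [/\ (* Part 1 *)
      (* for d = 1, P = [-1, 1] and W has two vertices and no edge *)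
      d <> 1%N ->
      [/\ forall x y, gvert W x -> gvert W y -> (gdist R W x y <= 3%:E)%E,
          forall x y, gvert W x -> gvert W y ->
            gdist R W x y = 3%:E -> y = - x &
          (gdiam R W <= 3%:E)%E],
      (* Part 2 *)
      d <> 1%N ->
      [/\ forall x y, vertices P x -> vertices P y ->
            (gdist R WV x y <= 3%:E)%E,
          forall x y, vertices P x -> vertices P y ->
            gdist R WV x y = 3%:E -> y = - x,
          (gdiam R WV <= 3%:E)%E &
          simplicial P -> WV = edge_graph P],
      (* Part 2: the graph on the vertices is determined by the face lattice *)
      forall (e : nat) (Q : set 'rV[R]_e), reflexive_polytope Q ->
        combinatorially_equivalent P Q ->
        graph_isomorphic WV (induced_subgraph (facet_graph Q) (vertices Q)) &
      (* Part 3 *)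
      forall F G, facet P F -> facet P G ->
        [\/ parallel F G,
            exists v, [/\ vertices P v, F v & G v] |
            exists H, [/\ facet P H, H <> F, H <> G,
                          F `&` H !=set0 & G `&` H !=set0]]].

Proof.
move=> W WV; have rP := reflexive_polytope_pair hP; split.
- exact (facet_graph_diameter rP).
- move=> d1; have [dist3 antipodal diam3] := vertex_graph_diameter rP d1.
  split=> //; exact (simplicial_edge_graph rP d1).
- move=> e Q hQ; apply: combinatorial_vertex_graph rP _.
  exact: reflexive_polytope_pair.
- by move=> F G; apply: facet_trichotomy rP.
Qed.
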